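(* There is an $\mathcal{O}(n)$ time algorithm that, given any map $f\in F(n)$ stored in an array, rearranges $f$ in-place, unstably, into an idempotent map $\iota\in I(n)$ using $2\log n$ bits of additional space.
   Context: $[n]=\{1,2,\ldots,n\}$. $F(n)$ is the set of all maps $f:[n]\to[n]$, represented as sequences $f(1),\ldots,f(n)$. $I(n)\subseteq F(n)$ is the set of idempotent maps, i.e. those $\iota$ with $\iota(\iota(x))=\iota(x)$ for all $x\in[n]$. ''Rearranges $f$ in-place into $\iota$'' means: $f$ is stored in an array $D[1\ldots n]$ with $D_i=f(i)$, and at termination the same array holds $\iota$ with $D_i=\iota(i)$, where $\iota=f\circ\tau$ for some permutation $\tau$ of $[n]$. ''Unstably'' means no claim is made on the relative order of equal elements. Computation is on a unit-cost random access machine; ''$c\log n$ bits'' means that besides the array $c$ auxiliary variables of $\log n$ bits each (indices or values of magnitude $O(n)$) are used. *)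

(* Defs.v *)
From mathcomp Require Import all_boot all_fingroup.

Set Implicit Arguments.
Unset Strict Implicit.
Unset Printing Implicit Defensive.

(** Maps [n] -> [n].  The set [n] is represented by 'I_n = {0, ..., n-1}, so
    array addresses and array values are both numbered from 0. *)

Definition is_idempotent n (g : {ffun 'I_n -> 'I_n}) : Prop :=
  forall x, g (g x) = g x.

Definition is_rearrangement n (f g : {ffun 'I_n -> 'I_n}) : Prop :=
  exists tau : {perm 'I_n}, forall x, g x = f (tau x).

(** A unit-cost random access machine whose only mutable data are an array D
    of n cells, each holding an element of 'I_n, and k index variables.
    A program is a finite list of instructions that does not depend on n; the
    length n is available as a read-only constant.  An instruction touches D
    only directly or through one level of indirection [D[r]], and apart from
    D, the k variables and the program counter no data survive from one
    instruction to the next. *)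

Inductive location k :=
| Reg of 'I_k
| Cell of 'I_k. (* the cell of D addressed by the variable *)

Inductive operand k :=
| Const of nat
| Length
| Content of location k.

Inductive instr k :=
| Move of location k & operand k
| Add of location k & operand k & operand k
| Sub of location k & operand k & operand k (* truncated at 0 *)
| JumpEq of operand k & operand k & nat
| JumpLt of operand k & operand k & nat.

Definition program k := seq (instr k).

Record config n k := Config {
  pc : nat;
  regs : {ffun 'I_k -> nat};
  arr : {ffun 'I_n -> 'I_n} }.

Definition read n k (c : config n k) (l : location k) : option nat :=
  match l with
  | Reg r => Some (regs c r)
  | Cell r => if insub (regs c r) is Some i then Some (val (arr c i)) else None
  end.

Definition value n k (c : config n k) (o : operand k) : option nat :=
  match o with
  | Const v => Some v
  | Length => Some n
  | Content l => read c l
  end.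

(* Addressing a cell outside D, or storing in D a number that is not in 'I_n,
   is a fault (None). *)
Definition write n k (c : config n k) (l : location k) (v : nat) :
    option (config n k) :=
  match l with
  | Reg r => Some (Config (pc c).+1
                     [ffun s => if s == r then v else regs c s] (arr c))
  | Cell r =>
      match insub (regs c r), insub v with
      | Some i, Some w => Some (Config (pc c).+1 (regs c)
                                  [ffun j => if j == i then w else arr c j])
      | _, _ => None
      end
  end.

Definition exec_binop n k (c : config n k) (op : nat -> nat -> nat)
    (l : location k) (a b : operand k) : option (config n k) :=
  match value c a, value c b with
  | Some x, Some y => write c l (op x y)
  | _, _ => None
  end.

Definition exec_jump n k (c : config n k) (test : nat -> nat -> bool)
    (a b : operand k) (target : nat) : option (config n k) :=
  match value c a, value c b with
  | Some x, Some y =>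
      Some (Config (if test x y then target else (pc c).+1) (regs c) (arr c))
  | _, _ => None
  end.

Definition exec_instr n k (c : config n k) (i : instr k) :
    option (config n k) :=
  match i with
  | Move l a => if value c a is Some v then write c l v else None
  | Add l a b => exec_binop c addn l a b
  | Sub l a b => exec_binop c subn l a b
  | JumpEq a b target => exec_jump c (fun x y => x == y) a b target
  | JumpLt a b target => exec_jump c (fun x y => x < y) a b target
  end.

Definition halted n k (P : program k) (c : config n k) : bool :=
  size P <= pc c.

(* No step is possible from a halted configuration or on a fault. *)
Definition step n k (P : program k) (c : config n k) : option (config n k) :=
  obind (exec_instr c) (onth P (pc c)).

Definition steps n k (P : program k) (t : nat) (c : config n k) :
    option (config n k) :=
  iter t (obind (step P)) (Some c).

Definition init n k (f : {ffun 'I_n -> 'I_n}) : config n k :=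
  Config 0 [ffun=> 0] f.

(* From the array f, P halts without fault after at most T steps, leaving g in
   the array, and no index variable ever exceeds M during the run. *)
Definition runs_within n k (P : program k) (T M : nat)
    (f g : {ffun 'I_n -> 'I_n}) : Prop :=
  (exists t, exists c : config n k,
     [/\ t <= T, steps P t (init k f) = Some c, halted P c & arr c = g]) /\
  (forall t (c : config n k),
     steps P t (init k f) = Some c -> forall r, regs c r <= M).

Definition linearly_bounded (T : nat -> nat) : Prop :=
  exists c n0, forall n, n0 <= n -> T n <= c * n.

(* Main.v *)
Require Import Defs.
From mathcomp Require Import all_boot all_fingroup.
From mathcomp Require Import zify.

Set Implicit Arguments.
Unset Strict Implicit.
Unset Printing Implicit Defensive.

(** A rearrangement of f is idempotent as soon as every value v that occurs in
    the array occurs in particular at address v.  For i = 0, ..., n-1, as long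
    as the value j = D[i] is missing at address j, exchange D[i] and D[j].
    Each exchange creates the fixed point j and destroys none, so there are at
    most n exchanges; the exchange itself needs no third variable, because the
    value to be stored in D[j] is the address j. *)

(** Total correctness by a ranking function: the second index of [Inv] drops at every step, so it
    bounds the length of the run. As the machine is deterministic, [Inv] holds at every
    configuration reached, which bounds the variables throughout. *)
Lemma runs_within_ranking n k (P : program k) (T M : nat)
    (f : {ffun 'I_n -> 'I_n}) (Inv : config n k -> nat -> Prop)
    (Post : {ffun 'I_n -> 'I_n} -> Prop) :
    Inv (init k f) T ->
    (forall c m, Inv c m -> ~~ halted P c ->
       exists c' m', [/\ step P c = Some c', Inv c' m' & m' < m]) ->
    (forall c m, Inv c m -> forall r, regs c r <= M) ->
    (forall c m, Inv c m -> halted P c -> Post (arr c)) ->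
  exists g, runs_within P T M f g /\ Post g.
Proof.
move=> Inv0 InvS InvM InvP.
have reached t c : steps P t (init k f) = Some c -> exists m, Inv c m.
  elim: t c => [|t IH] c; first by case=> <-; exists T.
  rewrite /steps iterS -/(steps P t (init k f)).
  case E: (steps P t (init k f)) => [c0|] //= stepc.
  have [m Inv_c0] := IH _ E.
  have run_c0 : ~~ halted P c0.
    apply/negP => halt_c0; move: stepc.
    by rewrite /step onth_default.
  have [c' [m' [stepc' Inv_c' _]]] := InvS _ _ Inv_c0 run_c0.
  by move: stepc; rewrite stepc' => -[<-]; exists m'.
have halts m c : Inv c m -> exists t c', [/\ t <= m, steps P t c = Some c',
    halted P c' & exists m', Inv c' m'].
  elim/ltn_ind: m c => m IH c Inv_c.
  have [halt_c|run_c] := boolP (halted P c).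
    by exists 0, c; split => //; exists m.
  have [c1 [m1 [step1 Inv1 lt_m1]]] := InvS _ _ Inv_c run_c.
  have [t [c' [le_t stepst halt' Inv']]] := IH _ lt_m1 _ Inv1.
  exists t.+1, c'; split=> //; first exact: leq_ltn_trans le_t lt_m1.
  by rewrite /steps iterSr /= step1.
have [t [c [le_t run_t halt_c [m Inv_c]]]] := halts _ _ Inv0.
exists (arr c); split; last exact: InvP Inv_c halt_c.
split; first by exists t, c.
by move=> s c1 /reached[m1 /InvM].
Qed.

Section Rearranging.

Variables (n : nat) (f : {ffun 'I_n -> 'I_n}).
Implicit Types (D : {ffun 'I_n -> 'I_n}) (i j : 'I_n).

Definition update D i v : {ffun 'I_n -> 'I_n} :=
  [ffun x => if x == i then v else D x].

Definition nfixed D := #|[set x | D x == x]|.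

(** Invariant of the loop over i; at [m = n] it is the whole claim about the array. *)
Definition settled D m :=
  is_rearrangement f D /\ forall x : 'I_n, x < m -> D (D x) = D x.

(** The updates are nested in the order of the two stores, so this is literally the array that the
    machine produces. *)
Definition send_home D i := update (update D i (D (D i))) (D i) (D i).

Lemma send_home_tperm D i x : send_home D i x = D (tperm i (D i) x).
Proof.
rewrite !ffunE; case: tpermP => [->|->|/eqP/negPf-> /eqP/negPf->] //.
  by rewrite eqxx; case: eqP => // e; rewrite -!e.
by rewrite eqxx.
Qed.

Lemma settled_send_home D i :
  D (D i) != D i -> settled D i -> settled (send_home D i) i.
Proof.
move=> DDi [[tau Dtau] fixD]; split.
  by exists (tperm i (D i) * tau)%g => x; rewrite send_home_tperm Dtau permM.
move=> x lt_xi; have ne_xi : (x == i) = false by rewrite -val_eqE ltn_eqF.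
rewrite !ffunE ne_xi; case: (x =P D i) => [|_]; first by rewrite eqxx.
case: (D x =P D i) => // ne_DxDi.
(* [D x = i] would give [D i = D (D x) = D x], which has just been excluded. *)
case: eqP => [Dxi|_]; last exact: fixD.
by case: ne_DxDi; rewrite -{1}(fixD x lt_xi) Dxi.
Qed.

(** Only the values at i and [D i] change. The address [D i] becomes a fixed point, and i was none
    before, since [D i = i] contradicts the hypothesis. *)
Lemma nfixed_send_home D i :
  D (D i) != D i -> nfixed D < nfixed (send_home D i).
Proof.
move=> DDi; apply: proper_card; apply/properP; split.
  apply/subsetP=> x; rewrite !inE !ffunE => /eqP Dx.
  case: (x =P D i) => [->|_]; first by rewrite eqxx.
  case: (x =P i) => [xi|_]; last by rewrite Dx.
  by move: DDi; rewrite -xi !Dx eqxx.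
by exists (D i); rewrite !inE // !ffunE eqxx.
Qed.

Lemma nfixed_le D : nfixed D <= n.
Proof. by rewrite -[leqRHS]card_ord max_card. Qed.

Lemma settledS D i : D (D i) = D i -> settled D i -> settled D i.+1.
Proof.
move=> DDi [rD fixD]; split=> // x; rewrite ltnS leq_eqVlt.
by case/predU1P => [/val_inj->|/fixD].
Qed.

Lemma settled_idempotent D : settled D n -> is_idempotent D.
Proof. by case=> _ fixD x; apply: fixD. Qed.

End Rearranging.

Definition reg_i : 'I_2 := ord0.
Definition reg_j : 'I_2 := ord_max.

(** Instruction 0 tests for the end, 1 to 5 form the exchange loop, 6 and 7 advance i, and 8 is past
    the end, hence halts. Comparing 0 with 0 gives an unconditional jump. *)
Definition home_program : program 2 :=
  let i := Content (Reg reg_i) in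
  let j := Content (Reg reg_j) in
  [:: JumpEq i (Length 2) 8;
      Move (Reg reg_j) (Content (Cell reg_i));
      JumpEq (Content (Cell reg_j)) j 6;
      Move (Cell reg_i) (Content (Cell reg_j));
      Move (Cell reg_j) j;
      JumpEq (Const 2 0) (Const 2 0) 1;
      Add (Reg reg_i) i (Const 2 1);
      JumpEq (Const 2 0) (Const 2 0) 0].

Definition regs_ij (i j : nat) : {ffun 'I_2 -> nat} :=
  [ffun r => if r == reg_i then i else j].

Lemma set_reg_i i j v :
  [ffun s => if s == reg_i then v else regs_ij i j s] = regs_ij v j.
Proof. by apply/ffunP=> s; rewrite !ffunE; case: eqP. Qed.

Lemma set_reg_j i j v :
  [ffun s => if s == reg_j then v else regs_ij i j s] = regs_ij i v.
Proof. by apply/ffunP=> s; rewrite !ffunE; case: s => [[|[|s]] ?]. Qed.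

Lemma regs_ij_i i j : regs_ij i j reg_i = i.
Proof. by rewrite ffunE. Qed.

Lemma regs_ij_j i j : regs_ij i j reg_j = j.
Proof. by rewrite ffunE. Qed.

(** Each advance of i costs five instructions (0, 1, 2, 6, 7), and so does each exchange (1 to
    5). *)
Definition work n (D : {ffun 'I_n -> 'I_n}) (i : nat) :=
  5 * (n - i) + 5 * (n - nfixed D).

(* The second index bounds the number of steps still to be made.  Between the
   two stores of an exchange (program counter 4) the array is not a
   rearrangement of f, so that case refers to the array D before the exchange. *)
Inductive home_inv n (f : {ffun 'I_n -> 'I_n}) : config n 2 -> nat -> Prop :=
| Inv0 D (i j : nat) of i <= n & j <= n & settled f D i :
    home_inv f (Config 0 (regs_ij i j) D) (work D i + 1)
| Inv1 D (i : 'I_n) (j : nat) of j <= n & settled f D i :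
    home_inv f (Config 1 (regs_ij i j) D) (work D i)
| Inv2 D (i : 'I_n) of settled f D i :
    home_inv f (Config 2 (regs_ij i (D i)) D) (work D i - 1)
| Inv3 D (i : 'I_n) of settled f D i & D (D i) != D i :
    home_inv f (Config 3 (regs_ij i (D i)) D) (work D i - 2)
| Inv4 D (i : 'I_n) of settled f D i & D (D i) != D i :
    home_inv f (Config 4 (regs_ij i (D i)) (update D i (D (D i))))
      (work D i - 3)
| Inv5 D (i : 'I_n) (j : nat) of j <= n & settled f D i :
    home_inv f (Config 5 (regs_ij i j) D) (work D i + 1)
| Inv6 D (i : 'I_n) (j : nat) of j <= n & settled f D i.+1 :
    home_inv f (Config 6 (regs_ij i j) D) (work D i - 2)
| Inv7 D (i j : nat) of i <= n & j <= n & settled f D i :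
    home_inv f (Config 7 (regs_ij i j) D) (work D i + 2)
| Inv8 D (i j : nat) of i <= n & j <= n & settled f D n :
    home_inv f (Config 8 (regs_ij i j) D) 0.

Lemma home_inv_step n (f : {ffun 'I_n -> 'I_n}) c m :
    home_inv f c m -> ~~ halted home_program c ->
  exists c' m', [/\ step home_program c = Some c', home_inv f c' m' & m' < m].
Proof.
have simE := (regs_ij_i, regs_ij_j, set_reg_i, set_reg_j).
case=> {c m} [D i j le_in le_jn sD | D i j le_jn sD | D i sD | D i sD DDi
  | D i sD DDi | D i j le_jn sD | D i j le_jn sD | D i j le_in le_jn sD
  | D i j le_in le_jn sD] // _; rewrite /step /=.
- rewrite /exec_jump /= !(simE, valK); case: (i =P n) => [eq_in|ne_in].
    do 2!eexists; split;
      [by [] | apply: (@Inv8 _ _ D i j) => // | lia].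
    by rewrite -{2}eq_in.
  have lt_in : i < n by lia.
  do 2!eexists; split; [by [] | exact: (Inv1 (i := Ordinal lt_in) le_jn sD) |].
  by rewrite addn1.
- rewrite /= !(simE, valK).
  do 2!eexists; split; [by [] | exact: Inv2 |].
  (* As [i < n], [work D i] is at least 5, so the subtractions in the ranks are never truncated. *)
  by have := ltn_ord i; rewrite /work; lia.
- rewrite /exec_jump /= !(simE, valK).
  case: ifP => [/eqP/val_inj DDi | /negbT DDi].
    do 2!eexists; split; [by [] | apply: Inv6 | ].
    + exact: ltnW.
    + exact: settledS.
    + by have := ltn_ord i; rewrite /work; lia.
  do 2!eexists; split; [by [] | apply: Inv3 => // |].
  by have := ltn_ord i; rewrite /work; lia.
- rewrite /= !(simE, valK).
  do 2!eexists; split; [by [] | apply: Inv4 => // |].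
  by have := ltn_ord i; rewrite /work; lia.
- rewrite /= !(simE, valK).
  do 2!eexists; split;
    [by [] | apply: (Inv5 (ltnW _) (settled_send_home DDi sD)) => // |].
  (* The new fixed point lowers [work] by at least 5, which pays for the jump back. *)
  have := ltn_ord i; have := nfixed_send_home DDi.
  by have := nfixed_le (send_home D i); rewrite /work; lia.
- rewrite /exec_jump /=.
  do 2!eexists; split; [by [] | exact: Inv1 |].
  by rewrite addn1.
- rewrite /exec_binop /= !(simE, valK) addn1.
  do 2!eexists; split; [by [] | exact: Inv7 |].
  by have := ltn_ord i; rewrite /work; lia.
- rewrite /exec_jump /=.
  do 2!eexists; split; [by [] | exact: Inv0 |].
  by rewrite ltn_add2l.
Qed.

Lemma home_inv_regs n (f : {ffun 'I_n -> 'I_n}) c m :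
  home_inv f c m -> forall r, regs c r <= n.
Proof.
by case=> * /=; rewrite ffunE; case: ifP => // _; apply: ltnW.
Qed.

(* The 2 log n bits of additional space are 2 variables of magnitude O(n). *)
Theorem theorem2p4 :
  exists P : program 2,
  exists T M : nat -> nat,
    [/\ linearly_bounded T, linearly_bounded M
      & forall (n : nat) (f : {ffun 'I_n -> 'I_n}),
        exists iota : {ffun 'I_n -> 'I_n},
          [/\ runs_within P (T n) (M n) f iota,
              is_rearrangement f iota
            & is_idempotent iota]].
Proof.
exists home_program, (fun n => 10 * n + 1), id; split.
- by exists 11, 1 => n; lia.
- by exists 1, 0 => n; lia.
move=> n f.
(* The exact rank depends on the fixed points of f; allowing any larger m gives the uniform start
   value [10 * n + 1]. *)
pose Inv c m := exists2 m', home_inv f c m' & m' <= m.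
have [||||iota [run_iota s_iota]] := @runs_within_ranking n 2 home_program
    (10 * n + 1) n f Inv (fun D => settled f D n).
- exists (work f 0 + 1); last by rewrite /work; lia.
  have -> : init 2 f = Config 0 (regs_ij 0 0) f.
    by congr Config; apply/ffunP=> r; rewrite !ffunE; case: ifP.
  apply: Inv0 => //; split=> //.
  by exists 1%g => x; rewrite perm1.
- move=> c m [m0 Ic le_m0] run_c.
  have [c' [m' [stepc Ic' lt_m']]] := home_inv_step Ic run_c.
  by exists c', m'; split=> //; [exists m' | apply: leq_trans le_m0].
- by move=> c m [m0 /home_inv_regs].
- by move=> c m [m0 [] //].
exists iota; split=> //; first by case: s_iota.
exact: settled_idempotent s_iota.
Qed.
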